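(* Let $H_R,H_B$ be finite sets, $H=H_R\cup H_B$, and for $\alpha\in\{R,B\}$ let $\mathcal{C}_\alpha$ be a collection of subsets of $H_\alpha$ that is increasing, i.e. $S\in\mathcal{C}_\alpha$ and $S\subseteq T\subseteq H_\alpha$ imply $T\in\mathcal{C}_\alpha$. Let $p_h\in[0,1]$ for $h\in H$. For $S\subseteq H$ let $\Pi_2(S)$ be the probability that both networks $R$ and $B$ get disabled under the $S$-strategy (described in the context). Then $\Pi_2(S)$ is an increasing function of $S$, i.e. $S\supseteq T$ implies $\Pi_2(S)\ge\Pi_2(T)$. In particular, the $H$-strategy maximizes the probability of disabling both networks over all $S$-strategies.
   Context: $H_\alpha$ is the set of sites at which network $\alpha\in\{R,B\}$ has a hub; $\mathcal{C}_\alpha$ is the collection of critical subsets of $H_\alpha$: network $\alpha$ is disabled precisely when the set of its destroyed hubs belongs to $\mathcal{C}_\alpha$. For each site $h\in H$ there are two weapons, $r_h$ and $b_h$, which destroy the red hub, respectively the blue hub, at site $h$ if such a hub exists there and the weapon hits the site. Weapons are carried by missiles; a missile aimed at $h$ hits $h$ with probability $p_h$, independently of all other missiles, and all weapons it carries then hit $h$ (if it misses, none of them do). Under the $S$-strategy ($S\subseteq H$), for each $h\in S$ the weapons $r_h,b_h$ are fired jointly on one missile, and for each $h\in H\setminus S$ they are fired separately on two missiles. Thus if $S_1$ (resp. $S_2$) is the random set of sites hit by the weapon $r_h$ (resp. $b_h$), network $R$ is disabled iff $S_1\cap H_R\in\mathcal{C}_R$ and network $B$ is disabled iff $S_2\cap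 H_B\in\mathcal{C}_B$. *)

(* Defs.v *)
From mathcomp Require Import all_boot all_order all_algebra.

Set Implicit Arguments.
Unset Strict Implicit.
Unset Printing Implicit Defensive.

Import Order.TTheory GRing.Theory Num.Theory.
Local Open Scope ring_scope.

Definition network : finType := bool.
Definition red : network := true.
Definition blue : network := false.

(* A missile is a target site together with its payload: [alpha \in m.2] says
   that m carries the weapon r_(m.1) (alpha = red) or b_(m.1) (alpha = blue). *)
Definition missile (T : finType) : finType := (T * {set network})%type.

Definition target (T : finType) (m : missile T) : T := m.1.
Definition payload (T : finType) (m : missile T) : {set network} := m.2.

Definition missiles (T : finType) (H S : {set T}) : {set missile T} :=
  [set m : missile T | (target m \in H) &&
    (if target m \in S then payload m == [set red; blue]
     else (payload m == [set red]) || (payload m == [set blue]))].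

(* An outcome is the set A of those fired missiles that hit their target.  The
   missiles of F hit independently, so the law is a product of Bernoulli laws. *)
Definition hit_prob (R : numDomainType) (T : finType) (p : T -> R)
    (F A : {set missile T}) : R :=
  \prod_(m in F) (if m \in A then p (target m) else 1 - p (target m)).

Definition Pr (R : numDomainType) (T : finType) (p : T -> R)
    (F : {set missile T}) (E : pred {set missile T}) : R :=
  \sum_(A in powerset F | E A) hit_prob p F A.

Definition sites_hit (T : finType) (A : {set missile T}) (alpha : network) :
    {set T} :=
  [set target m | m in A & alpha \in payload m].

Definition disabled (T : finType) (Halpha : {set T}) (Calpha : {set {set T}})
    (alpha : network) (A : {set missile T}) : bool :=
  sites_hit A alpha :&: Halpha \in Calpha.

Definition collection_of_subsets (T : finType) (H : {set T})
    (C : {set {set T}}) : Prop :=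
  forall S : {set T}, S \in C -> S \subset H.

Definition increasing (T : finType) (H : {set T}) (C : {set {set T}}) : Prop :=
  forall S U : {set T}, S \in C -> S \subset U -> U \subset H -> U \in C.

Definition Pi2 (R : numDomainType) (T : finType) (HR HB : {set T})
    (CR CB : {set {set T}}) (p : T -> R) (S : {set T}) : R :=
  Pr p (missiles (HR :|: HB) S)
    (fun A => disabled HR CR red A && disabled HB CB blue A).

Lemma Pr_total (R : numDomainType) (T : finType) (p : T -> R)
    (F : {set missile T}) : Pr p F predT = 1.
Proof.
pose f m : R := if m \in F then p (target m) else 0.
pose g m : R := if m \in F then 1 - p (target m) else 1.
have fg m : f m + g m = 1 by rewrite /f /g; case: ifP; rewrite ?add0r // addrC subrK.
transitivity (\prod_m (f m + g m)); last by rewrite big1.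
rewrite bigA_distr /Pr [RHS](bigID (fun A : {set missile T} => A \subset F)) /=.
rewrite [X in _ + X]big1 ?addr0; last first.
  move=> A /subsetPn[m mA mF].
  by rewrite (bigD1 m) //= mA /f (negbTE mF) mul0r.
apply: eq_big => [A|A]; first by rewrite powersetE andbT.
rewrite andbT powersetE => AF; rewrite /hit_prob big_mkcond.
apply: eq_bigr => m _; rewrite /f /g.
by case: ifP => mF //; case: ifP => // /(subsetP AF); rewrite mF.
Qed.

(* Main.v *)
(* It suffices to add one site h to the set of joint shots.  Fix the outcome of
   all missiles not aimed at h, and let a1, a0 (resp. b1, b0) be the indicators
   that the red (resp. blue) network is disabled when its hub at h is, resp. is
   not, hit.  Firing jointly rather than separately at h then changes the
   conditional probability by p_h (1 - p_h) (a1 - a0) (b1 - b0), which is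
   nonnegative since the critical collections are increasing. *)
Require Import Defs.
From mathcomp Require Import all_boot all_order all_algebra.
From mathcomp Require Import ring lra.

Set Implicit Arguments.
Unset Strict Implicit.
Unset Printing Implicit Defensive.

Import Order.TTheory GRing.Theory Num.Theory.
Local Open Scope ring_scope.

(** Averaging over the outcome of one missile turns the indicator of an event into a weighted sum of
    two indicators, so real-valued integrands are used in place of events. *)
Definition expectation (R : numDomainType) (T : finType) (p : T -> R)
    (F : {set missile T}) (f : {set missile T} -> R) : R :=
  \sum_(A in powerset F) hit_prob p F A * f A.

Lemma Pr_expectation (R : numDomainType) (T : finType) (p : T -> R)
    (F : {set missile T}) (E : pred {set missile T}) :
  Pr p F E = expectation p F (fun A => (E A)%:R).
Proof.
rewrite /Pr /expectation big_mkcondr; apply: eq_bigr => A _.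
by case: (E A); rewrite ?mulr1 ?mulr0.
Qed.

Lemma hit_prob_setU1 (R : numDomainType) (T : finType) (p : T -> R)
    (m : missile T) (F A : {set missile T}) : m \notin F ->
  hit_prob p (m |: F) A =
  (if m \in A then p (target m) else 1 - p (target m)) * hit_prob p F A.
Proof. by move=> mF; rewrite /hit_prob big_setU1. Qed.

Lemma hit_prob_setU1r (R : numDomainType) (T : finType) (p : T -> R)
    (m : missile T) (F A : {set missile T}) : m \notin F ->
  hit_prob p F (m |: A) = hit_prob p F A.
Proof.
move=> mF; apply: eq_bigr => m' m'F; rewrite in_setU1.
by case: eqP m'F mF => [->->|].
Qed.

(** Conditioning on whether [m] hits: the outcomes containing [m] correspond to the subsets of [F]
    via [A |-> m |: A], and the others are exactly the subsets of [F]. *)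
Lemma expectation_setU1 (R : numDomainType) (T : finType) (p : T -> R)
    (m : missile T) (F : {set missile T}) (f : {set missile T} -> R) :
  m \notin F ->
  expectation p (m |: F) f =
  expectation p F
    (fun A => p (target m) * f (m |: A) + (1 - p (target m)) * f A).
Proof.
move=> mF; rewrite /expectation (bigID (fun A : {set _} => m \in A)) /=.
have notin (A : {set missile T}) : A \subset F -> m \notin A.
  by move=> /subsetP AF; apply: contra mF => /AF.
rewrite (reindex_onto (fun A => m |: A) (fun A => A :\ m)) /=; last first.
  by move=> A /andP[_ mA]; rewrite setD1K.
transitivity (\sum_(A in powerset F)
    hit_prob p F A * (p (target m) * f (m |: A)) +
  \sum_(A in powerset F) hit_prob p F A * ((1 - p (target m)) * f A)).
  congr (_ + _); apply: eq_big => A.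
  - rewrite !powersetE setU11 andbT; apply/andP/idP => [[AF /eqP <-]|AF].
      by rewrite subDset.
    by rewrite setUS // setU1K ?notin.
  - by rewrite hit_prob_setU1 // setU11 hit_prob_setU1r // => _; ring.
  - rewrite !powersetE; apply/andP/idP => [[AF mA]|AF].
      by rewrite -(setU1K mF) subsetD1 AF.
    by rewrite notin // subsetU // AF orbT.
  - by move=> /andP[_ /negbTE mA]; rewrite hit_prob_setU1 // mA; ring.
by rewrite -big_split; apply: eq_bigr => A _; rewrite mulrDr.
Qed.

Lemma ler_expectation (R : numDomainType) (T : finType) (p : T -> R)
    (F : {set missile T}) (f g : {set missile T} -> R) :
  (forall m, m \in F -> 0 <= p (target m) <= 1) ->
  (forall A, f A <= g A) -> expectation p F f <= expectation p F g.
Proof.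
move=> p01 fg; apply: ler_sum => A _; apply: ler_wpM2l => //.
apply: prodr_ge0 => m /p01 /andP[p0 p1].
by case: ifP => _ //; rewrite subr_ge0.
Qed.

Lemma sites_hit_setU1 (T : finType) (m : missile T) (A : {set missile T})
    (alpha : network) :
  sites_hit (m |: A) alpha =
  if alpha \in payload m then target m |: sites_hit A alpha
  else sites_hit A alpha.
Proof.
apply/setP => x; apply/imsetP/idP => [[m']|].
  rewrite inE in_setU1 => /andP[/predU1P[->|m'A] al ->].
    by rewrite al setU11.
  have xA : target m' \in sites_hit A alpha.
    by apply/imsetP; exists m'; rewrite ?inE ?m'A.
  by case: ifP; rewrite // in_setU1 xA orbT.
have old : x \in sites_hit A alpha ->
    exists2 m', m' \in [set m' in m |: A | alpha \in payload m'] & x = target m'.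
  by case/imsetP => m'; rewrite inE => /andP[m'A al] ->; exists m';
    rewrite // inE in_setU1 m'A orbT.
case: ifP => // al; rewrite in_setU1 => /predU1P[->|//].
by exists m; rewrite // inE setU11.
Qed.

(** Provides the implications [a0 -> a1] and [b0 -> b1] between the indicators. *)
Lemma critical_setU1 (T : finType) (H : {set T}) (C : {set {set T}})
    (h : T) (X : {set T}) :
  increasing H C -> X :&: H \in C -> (h |: X) :&: H \in C.
Proof.
by move=> incr XC; apply: (incr _ _ XC); rewrite ?subsetIr // setSI ?subsetUr.
Qed.

(** The missiles common to the strategies for [S] and for [h |: S]; their outcome is the one held
    fixed. *)
Definition missiles_off (T : finType) (H S : {set T}) (h : T) :
    {set missile T} :=
  [set m in missiles H S | target m != h].

Lemma missiles_joint (T : finType) (H S : {set T}) (h : T) :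
  h \in H -> missiles H (h |: S) = (h, [set red; blue]) |: missiles_off H S h.
Proof.
move=> hH; apply/setP => -[x P].
rewrite !inE /target /payload xpair_eqE /=.
by case: (eqVneq x h) => [->|_] /=; rewrite ?hH ?andbF ?orbF ?andbT.
Qed.

Lemma missiles_separate (T : finType) (H S : {set T}) (h : T) :
  h \in H -> h \notin S ->
  missiles H S =
  (h, [set red]) |: ((h, [set blue]) |: missiles_off H S h).
Proof.
move=> hH /negbTE hS; apply/setP => -[x P].
rewrite !inE /target /payload !xpair_eqE /=.
by case: (eqVneq x h) => [->|_] /=; rewrite ?hH ?hS ?andbF ?orbF ?andbT.
Qed.

Lemma joint_ge_separate (R : realFieldType) (q : R) (a0 a1 b0 b1 : bool) :
  0 <= q <= 1 -> (a0 -> a1) -> (b0 -> b1) ->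
  q * (q * (a1 && b1)%:R + (1 - q) * (a0 && b1)%:R) +
    (1 - q) * (q * (a1 && b0)%:R + (1 - q) * (a0 && b0)%:R) <=
  q * (a1 && b1)%:R + (1 - q) * (a0 && b0)%:R.
Proof.
move=> /andP[q0 q1] a01 b01.
(* The gap is [q * (1 - q)] when [a0], [b0] are false and [a1], [b1] true, and zero in every other
   admissible case. *)
have q2 : 0 <= q * (1 - q) by rewrite mulr_ge0 ?subr_ge0.
case: a0 a1 b0 b1 a01 b01 => [] [] [] [] /= a01 b01;
  by [have := a01 isT | have := b01 isT | nra].
Qed.

Lemma Pi2_setU1 (R : realFieldType) (T : finType) (HR HB : {set T})
    (CR CB : {set {set T}}) (p : T -> R) (S : {set T}) (h : T) :
  increasing HR CR -> increasing HB CB ->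
  (forall x : T, x \in HR :|: HB -> 0 <= p x <= 1) ->
  h \in HR :|: HB -> h \notin S ->
  Pi2 HR HB CR CB p S <= Pi2 HR HB CR CB p (h |: S).
Proof.
move=> CRi CBi p01 hH hS.
have off (P : {set network}) : (h, P) \notin missiles_off (HR :|: HB) S h.
  by rewrite inE /target eqxx andbF.
have rb : (h, [set red]) != (h, [set blue]) :> missile T.
  by rewrite xpair_eqE eqxx /=; apply/eqP => /setP /(_ red); rewrite !inE.
rewrite /Pi2 !Pr_expectation missiles_joint // (missiles_separate hH hS).
(* Peeling off the two separate missiles on the left and the joint one on the right leaves
   expectations over the same [missiles_off], so the integrands can be compared outcome by
   outcome. *)
rewrite !expectation_setU1 ?in_setU1 ?negb_or ?rb ?off //.
apply: ler_expectation => [m|A].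
  by rewrite !inE => /andP[/andP[mH _] _]; apply: p01; rewrite in_setU.
rewrite /disabled !sites_hit_setU1 /payload /target /= !inE /=.
by apply: joint_ge_separate; [apply: p01 | apply: critical_setU1 CRi | apply: critical_setU1 CBi].
Qed.

Theorem proposition2 (R : realFieldType) (T : finType) (HR HB : {set T})
    (CR CB : {set {set T}}) (p : T -> R)
    (CR_sub : collection_of_subsets HR CR) (CR_incr : increasing HR CR)
    (CB_sub : collection_of_subsets HB CB) (CB_incr : increasing HB CB)
    (p01 : forall h : T, h \in HR :|: HB -> 0 <= p h <= 1) :
  (forall S S' : {set T}, S \subset HR :|: HB -> S' \subset S ->
     Pi2 HR HB CR CB p S' <= Pi2 HR HB CR CB p S) /\
  (forall S : {set T}, S \subset HR :|: HB ->
     Pi2 HR HB CR CB p S <= Pi2 HR HB CR CB p (HR :|: HB)).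
Proof.
suff mono (S S' : {set T}) : S \subset HR :|: HB -> S' \subset S ->
    Pi2 HR HB CR CB p S' <= Pi2 HR HB CR CB p S.
  by split=> [//|S SH]; apply: mono.
(* Induction on a strict bound for the number of sites of [S] missing from [S']: each round moves
   one such site [h] into [S']. *)
move=> SH; have [n] := ubnP #|S :\: S'|; elim: n S' => // n IHn S' ltn S'S.
have [S0|[h]] := set_0Vmem (S :\: S').
  suff -> : S' = S by [].
  by apply/eqP; rewrite eqEsubset S'S -setD_eq0 S0 eqxx.
move=> hD; have := hD; rewrite inE => /andP[hS' hS].
apply: le_trans (Pi2_setU1 _ _ _ (subsetP SH h hS) hS') _ => //.
apply: IHn; last by rewrite subUset sub1set hS.
by move: ltn; rewrite (cardsD1 h) hD setDDl setUC ltnS.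
Qed.
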